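(* Let $\mathbb{F}$ be any field, $S\subseteq\mathbb{A}$ finite and $\mathcal{O}\subseteq\mathbb{A}^I$ an $S$-ordered orbit. Every nonzero $\operatorname{Aut}(\mathbb{A}/S)$-invariant subspace $V\subseteq\operatorname{Lin}_{\mathbb{F}}\mathcal{O}$ contains $\operatorname{Cog}_{\mathbb{F}}\mathcal{O}$. In particular $\operatorname{Cog}_{\mathbb{F}}\mathcal{O}$ is nonzero and has no $\operatorname{Aut}(\mathbb{A}/S)$-invariant subspaces other than $0$ and itself.
   Context: $\mathbb{A}$ is the Fraïssé limit of the class of all totally ordered (new symbol $<$) members of a free amalgamation class $\mathscr{C}_0=\operatorname{Forb}(\mathscr{F})$ of finite irreflexive $\sigma_0$-structures, $\sigma_0$ finite with unary and binary relations (in each member of $\mathscr{F}$ any two elements $u,v$ are related: $u=v$ or $R(u,v)$ or $R(v,u)$ for some binary $R$; irreflexive: binary relations hold only between distinct elements). $\operatorname{Aut}(\mathbb{A}/S)$ is the group of automorphisms fixing $S$ pointwise. $I$ is a finite totally ordered index set; $a\in\mathbb{A}^I$ is $S$-ordered if $a_i\notin S$ and $a_i<a_j$ for $i<j$; $\mathcal{O}=\operatorname{Aut}(\mathbb{A}/S)\cdot a$ for such $a$. $\operatorname{Lin}_{\mathbb{F}}\mathcal{O}$ is the space of finite formal linear combinations of elements of $\mathcal{O}$. An $\mathcal{O}$-duo $a\parallel b$ is a pair $a,b\in\mathcal{O}$ with $a_i<b_i$ for all $i$, $b_i<a_j$ for $i<j$, and $R(a_i,b_j)\iff R(a_i,a_j)\iff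 R(b_i,b_j)\iff R(b_i,a_j)$ for all binary $R\in\sigma_0$, $i,j\in I$. The cog is $a\between b=\sum_{J\subseteq I}(-1)^{|J|}c^J$ where $c^J_i=b_i$ for $i\in J$ and $c^J_i=a_i$ otherwise; $\operatorname{Cog}_{\mathbb{F}}\mathcal{O}$ is the span of all $\mathcal{O}$-cogs. *)

(* Defs.v *)
From HB Require Import structures.
From mathcomp Require Import all_boot all_order all_algebra.
Set Implicit Arguments. Unset Strict Implicit. Unset Printing Implicit Defensive.
Import GRing.Theory.
Local Open Scope ring_scope.

Section Structures.
Variables (nu nb : nat).

Record sig0str (T : Type) := Sig0Str {
  urel : 'I_nu -> T -> bool;
  brel : 'I_nb -> T -> T -> bool }.

Record ostr (T : Type) := OStr {
  ored : sig0str T;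
  olt : T -> T -> bool }.

Definition irreflexive0 T (M : sig0str T) := forall r x, brel M r x x = false.

Definition embedding0 X Y (MX : sig0str X) (MY : sig0str Y) (f : X -> Y) :=
  injective f /\
  (forall r x, urel MY r (f x) = urel MX r x) /\
  (forall r x y, brel MY r (f x) (f y) = brel MX r x y).

Definition oembedding X Y (MX : ostr X) (MY : ostr Y) (f : X -> Y) :=
  embedding0 (ored MX) (ored MY) f /\
  (forall x y, olt MY (f x) (f y) = olt MX x y).

Definition strict_total_order T (lt : T -> T -> bool) :=
  (forall x, lt x x = false) /\
  (forall x y z, lt x y -> lt y z -> lt x z) /\
  (forall x y, x <> y -> lt x y \/ lt y x).

Section Forb.
Variables (Jf : Type) (Fdom : Jf -> finType) (Fstr : forall j, sig0str (Fdom j)).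

Definition forb_family_ok :=
  forall j (u v : Fdom j), u = v \/ exists r, brel (Fstr j) r u v \/ brel (Fstr j) r v u.

Definition inC0 (X : finType) (M : sig0str X) :=
  irreflexive0 M /\ forall j (f : Fdom j -> X), ~ embedding0 (Fstr j) M f.

Definition inK (X : finType) (M : ostr X) :=
  strict_total_order (olt M) /\ inC0 (ored M).

Definition automorphism T (M : ostr T) (h : T -> T) :=
  bijective h /\ oembedding M M h.

Definition fraisse_limit (A : countType) (MA : ostr A) :=
  (forall (X : finType) (MX : ostr X),
      (exists f : X -> A, oembedding MX MA f) <-> inK MX) /\
  (* every isomorphism f x |-> g x between finite substructures extends
     to an automorphism *)
  (forall (X : finType) (f g : X -> A), injective f -> injective g ->
      (forall r x, urel (ored MA) r (f x) = urel (ored MA) r (g x)) ->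
      (forall r x y, brel (ored MA) r (f x) (f y) = brel (ored MA) r (g x) (g y)) ->
      (forall x y, olt MA (f x) (f y) = olt MA (g x) (g y)) ->
      exists h, automorphism MA h /\ forall x, h (f x) = g x).
End Forb.

Section Orbits.
Variables (A : countType) (MA : ostr A) (S : seq A) (n : nat).

Definition tup := {ffun 'I_n -> A}.

Definition autS (h : A -> A) := automorphism MA h /\ forall s, s \in S -> h s = s.

Definition tmap (h : A -> A) (c : tup) : tup := [ffun i => h (c i)].

Definition S_ordered (a : tup) :=
  (forall i, a i \notin S) /\ (forall i j : 'I_n, (i < j)%N -> olt MA (a i) (a j)).

Variable a : tup.

Definition inO (c : tup) := exists h, autS h /\ c = tmap h a.

Definition duo (c d : tup) :=
  inO c /\ inO d /\
  (forall i, olt MA (c i) (d i)) /\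
  (forall i j : 'I_n, (i < j)%N -> olt MA (d i) (c j)) /\
  (forall r i j,
     let R := brel (ored MA) r in
     (R (c i) (d j) = R (c i) (c j)) /\ (R (c i) (c j) = R (d i) (d j)) /\
     (R (d i) (d j) = R (d i) (c j))).

Definition cJ (c d : tup) (J : {set 'I_n}) : tup :=
  [ffun i => if i \in J then d i else c i].

Variable F : fieldType.

(* formal linear combinations are represented as coefficient functions *)
Definition vec := tup -> F.

Definition cog (c d : tup) : vec :=
  fun e => \sum_(J : {set 'I_n}) (-1) ^+ #|J| * (e == cJ c d J)%:R.

Definition inLin (v : vec) :=
  (exists s : seq tup, forall c, v c != 0 -> c \in s) /\
  (forall c, v c != 0 -> inO c).

Definition inCog (v : vec) :=
  exists m (r : 'I_m -> F) (c d : 'I_m -> tup),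
    (forall k, duo (c k) (d k)) /\
    forall e, v e = \sum_(k < m) r k * cog (c k) (d k) e.

Definition subspace (V : vec -> Prop) :=
  V (fun _ => 0) /\
  (forall v w, V v -> V w -> V (fun e => v e + w e)) /\
  (forall k v, V v -> V (fun e => k * v e)).

(* Aut(A/S)-invariance: with (h.v)(h.c) = v(c) *)
Definition aut_invariant (V : vec -> Prop) :=
  forall h, autS h -> forall v w, V v -> (forall c, w (tmap h c) = v c) -> V w.

End Orbits.
End Structures.

(* Main.v *)
Require Import Defs.
From Stdlib Require Import Classical.
From mathcomp Require Import all_boot all_order all_algebra.
Import GRing.Theory.
Local Open Scope ring_scope.

(** Let [c] be in the support of [v], and let [T] be a finite set containing [S]
and all entries of tuples in the support of [v].  Since forbidden structures are
cliques, a twin [d i] of each [c i] can be added to [T], unrelated to [c i] and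
placed immediately above it.  For every [J], the map sending [c i] to [d i] for
[i \in J] and fixing the rest of [T] is a partial isomorphism, so it extends to
some [h J] in Aut(A/S).  In the alternating sum of the [h J v], a tuple that
misses some entry [c i] cancels; as all tuples are increasing, only [c] survives,
and the sum is [v c] times the cog of [c] and [d].  Finally, the relations being
binary, all duos are conjugate under Aut(A/S). *)

Section Fraisse.
Set Implicit Arguments.
Unset Strict Implicit.
Unset Printing Implicit Defensive.

Variables (nu nb : nat) (Jf : Type) (Fdom : Jf -> finType).
Variable Fstr : forall j, sig0str nu nb (Fdom j).
Hypothesis hF : forb_family_ok Fstr.

(** * Doubling points of an ordered structure *)

Definition blowup_base (X I : Type) (c : I -> X) (z : X + I) : X :=
  match z with inl x => x | inr i => c i end.

Definition is_inr (X I : Type) (z : X + I) : bool :=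
  if z is inr _ then true else false.

(** Pulling the relations back along [blowup_base] leaves a copy and its original unrelated when [M]
    is irreflexive; the order puts the copy immediately above the original. *)
Definition blowup (X : eqType) (I : Type) (M : ostr nu nb X) (c : I -> X) :
    ostr nu nb (X + I) :=
  let p := blowup_base c in
  OStr (Sig0Str (fun r z => urel (ored M) r (p z))
                (fun r z w => brel (ored M) r (p z) (p w)))
       (fun z w => olt M (p z) (p w) ||
                   (p z == p w) && (~~ is_inr z && is_inr w)).

(* A forbidden structure, being a clique, contains no two copies of the same point. *)
Lemma blowup_inK (X I : finType) (M : ostr nu nb X) (c : I -> X) :
  injective c -> inK Fstr M -> inK Fstr (blowup M c).
Proof.
move=> cI [[irr [tr tot]] [irr0 forb]]; split; first split.
- by move=> z /=; rewrite irr; case: z => z; rewrite /= ?andbF.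
- split.
  + move=> x y z /orP[xy|/andP[/eqP exy /andP[nx y1]]]
      /orP[yz|/andP[/eqP eyz /andP[ny z1]]] /=.
    * by rewrite (tr _ _ _ xy yz).
    * by rewrite -eyz xy.
    * by rewrite exy yz.
    * by rewrite y1 in ny.
  + move=> x y nxy /=.
    case: (eqVneq (blowup_base c x) (blowup_base c y)) => [e|/eqP/tot[]->];
      [|by left|by right].
    case: x y nxy e => [x|i] [y|j] nxy /= e; rewrite ?orbT; auto.
    * by case: nxy; rewrite e.
    * by case: nxy; rewrite (cI _ _ e).
- split=> [r x|j f [fI [fu fb]]]; first exact: irr0.
apply: (forb j (fun u => blowup_base c (f u))); split; last by split.
move=> u v e; case: (hF u v) => // -[r [] h]; move: h; rewrite -fb /= e irr0 //.
Qed.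

(** * The Fraïssé limit: types, homogeneity and twins *)

Variables (A : countType) (MA : ostr nu nb A).
Hypothesis hA : fraisse_limit Fstr MA.

Definition same_type (X : Type) (f g : X -> A) :=
  [/\ forall r x, urel (ored MA) r (f x) = urel (ored MA) r (g x),
      forall r x y, brel (ored MA) r (f x) (f y) = brel (ored MA) r (g x) (g y)
    & forall x y, olt MA (f x) (f y) = olt MA (g x) (g y)].

Lemma same_type_trans (X : Type) (f g k : X -> A) :
  same_type f g -> same_type g k -> same_type f k.
Proof. by case=> h1 h2 h3 [*]; split=> *; rewrite (h1, h2, h3). Qed.

Lemma same_type_aut (X : Type) (f g : X -> A) (h : A -> A) :
  automorphism MA h -> (forall x, g x = h (f x)) -> same_type f g.
Proof.
by case=> _ [[_ [hu hb]] ho] fg; split=> *; rewrite !fg ?hu ?hb ?ho.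
Qed.

Definition sub_ostr (T : seq A) : ostr nu nb (seq_sub T) :=
  OStr (Sig0Str (fun r x => urel (ored MA) r (ssval x))
                (fun r x y => brel (ored MA) r (ssval x) (ssval y)))
       (fun x y => olt MA (ssval x) (ssval y)).

(** This allows the order axioms of [MA] to be read off substructures with at most three points, and
    finite substructures to be blown up. *)
Lemma sub_inK (T : seq A) : inK Fstr (sub_ostr T).
Proof.
apply/(proj1 hA); exists (@ssval _ T); split=> //; split=> //.
exact: val_inj.
Qed.

Lemma olt_irr x : olt MA x x = false.
Proof.
have [[irr _] _] := sub_inK [:: x].
exact: (irr (SeqSub (mem_head x [::]))).
Qed.

Lemma olt_trans : transitive (olt MA).
Proof.
move=> y x z; have [[_ [tr _]] _] := sub_inK [:: x; y; z].
have hx : x \in [:: x; y; z] by rewrite !inE eqxx.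
have hy : y \in [:: x; y; z] by rewrite !inE eqxx orbT.
have hz : z \in [:: x; y; z] by rewrite !inE eqxx !orbT.
exact: (tr (SeqSub hx) (SeqSub hy) (SeqSub hz)).
Qed.

Lemma olt_total x y : x <> y -> olt MA x y \/ olt MA y x.
Proof.
move=> nxy; have [[_ [_ tot]] _] := sub_inK [:: x; y].
have hx : x \in [:: x; y] by rewrite !inE eqxx.
have hy : y \in [:: x; y] by rewrite !inE eqxx orbT.
by apply: (tot (SeqSub hx) (SeqSub hy)) => -[].
Qed.

Lemma olt_asym x y : olt MA x y -> olt MA y x = false.
Proof. by move=> xy; apply/negP => /(olt_trans xy); rewrite olt_irr. Qed.

(** The maps [f] and [g] may repeat values. The order determines equality, so they have the same
    kernel, and the Fraïssé condition can be applied on the finite set [codom f]. *)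
Lemma homogeneity (X : finType) (f g : X -> A) :
  same_type f g -> exists h, automorphism MA h /\ forall x, h (f x) = g x.
Proof.
case=> fu fb fo.
have fg x y : f x = f y -> g x = g y.
  move=> e; apply: NNPP => /olt_total.
  by rewrite -!fo e olt_irr; case.
pose p (y : seq_sub (codom f)) : X := iinv (ssvalP y).
have fp y : f (p y) = ssval y by rewrite /p f_iinv.
have gp x : g (p (SeqSub (codom_f f x))) = g x by apply: fg; rewrite fp.
have [|||||h [hh hp]] := (proj2 hA _ (@ssval _ (codom f)) (fun y => g (p y))).
- exact: val_inj.
- move=> x y e; apply: val_inj => /=; apply: NNPP => /olt_total.
  by rewrite -!fp !fo e olt_irr; case.
- by move=> r x; rewrite -fp.
- by move=> r x y; rewrite -!fp.
- by move=> x y; rewrite -!fp.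
by exists h; split=> // x; rewrite -gp -hp.
Qed.

(** The blow-up lies in the class, so it embeds somewhere into [MA]; homogeneity then moves the
    image of [T] back onto [T]. *)
Lemma twins (T : seq A) (I : finType) (c : I -> seq_sub T) :
  injective c ->
  exists e : seq_sub T + I -> A,
    (forall t, e (inl t) = ssval t) /\ oembedding (blowup (sub_ostr T) c) MA e.
Proof.
move=> cI; have /(proj1 hA)[e [[eI [eu eb]] eo]] := blowup_inK cI (sub_inK T).
have [|h [[hb [[hI [hu hr]] ho]] he]] :=
  @homogeneity (seq_sub T) (fun t => e (inl t)) (@ssval _ T).
  by split=> *; rewrite ?eu ?eb ?eo //= andbF orbF.
exists (fun z => h (e z)); split=> //.
split; last by move=> x y; rewrite ho eo.
split; first by move=> x y /hI /eI.
by split=> *; rewrite ?hu ?hr ?eu ?eb.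
Qed.

(** * Types and homogeneity over [S] *)

Variable S : seq A.

(** Appending the points of [S] turns types with parameters in [S] into plain types. *)
Definition over (X : Type) (f : X -> A) (z : X + seq_sub S) : A :=
  match z with inl x => f x | inr s => ssval s end.

Lemma homogeneity_over (X : finType) (f g : X -> A) :
  same_type (over f) (over g) -> exists h, autS MA S h /\ forall x, h (f x) = g x.
Proof.
move=> /homogeneity[h [hh he]]; exists h; split; last by move=> x; exact: (he (inl x)).
by split=> // s sS; exact: (he (inr (SeqSub sS))).
Qed.

Lemma same_type_over_aut (X : Type) (f g : X -> A) (h : A -> A) :
  autS MA S h -> (forall x, g x = h (f x)) -> same_type (over f) (over g).
Proof.
case=> hh hS fg; apply: (same_type_aut hh).
by case=> [x|[s sS]] /=; [exact: fg | rewrite hS].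
Qed.

Lemma autS_id : autS MA S id.
Proof. by split=> //; split; [exists id | do !split]. Qed.

Lemma autS_injective h : autS MA S h -> injective h.
Proof. by case=> -[/bij_inj]. Qed.

(** * Increasing tuples *)

Variable n : nat.
Implicit Types c d e x : tup A n.

Lemma tmap_injective (h : A -> A) : injective h -> injective (@tmap A n h).
Proof. by move=> hI x y /ffunP e; apply/ffunP => i; have := e i; rewrite !ffunE => /hI. Qed.

Definition increasing c := forall i j : 'I_n, (i < j)%N -> olt MA (c i) (c j).

Lemma increasing_olt c (i j : 'I_n) : increasing c -> olt MA (c i) (c j) = (i < j)%N.
Proof.
move=> cm; case: (ltngtP i j) => [/cm//|/cm/olt_asym//|/val_inj ->].
exact: olt_irr.
Qed.

Lemma increasing_inj c : increasing c -> injective c.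
Proof.
move=> cm i j e; apply: val_inj => /=.
case: (ltngtP i j) => // /cm; rewrite e olt_irr //.
Qed.

Lemma increasing_sorted c : increasing c -> sorted (olt MA) (codom c).
Proof.
move=> cm; rewrite codomE sorted_map.
apply: (@sub_sorted _ (relpre val ltn)); first by move=> i j /cm.
by rewrite -sorted_map val_enum_ord iota_ltn_sorted.
Qed.

(** The [n] distinct entries of [c] exhaust those of [x], and an increasing tuple is the sorted list
    of its entries. *)
Lemma increasing_codom_eq c x :
  increasing c -> increasing x -> (forall i, c i \in codom x) -> c = x.
Proof.
move=> cm xm cx.
have sub : {subset codom c <= codom x} by move=> y /codomP[i ->].
have uc : uniq (codom c) by apply/injectiveP/increasing_inj.
have [_ mem] := uniq_min_size uc sub (eq_leq (etrans (size_codom x) (esym (size_codom c)))).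
have e : codom c = codom x.
  by apply: (irr_sorted_eq olt_trans olt_irr); rewrite ?increasing_sorted.
apply/ffunP => i.
by move: e; rewrite !codomE => /eq_in_map; apply; rewrite mem_enum.
Qed.

(** * The orbit of [a] and its duos *)

Variable a : tup A n.
Hypothesis ha : S_ordered MA S a.

Notation inO := (inO MA S a).
Notation duo := (duo MA S a).

Lemma inO_type c : inO c <-> same_type (over a) (over c).
Proof.
split=> [[h [hh ->]]|/homogeneity_over[h [hh he]]].
  by apply: same_type_over_aut hh _ => i; rewrite ffunE.
by exists h; split=> //; apply/ffunP => i; rewrite ffunE he.
Qed.

Lemma inO_refl : inO a.
Proof. by apply/inO_type. Qed.

Lemma inO_tmap c h : inO c -> autS MA S h -> inO (tmap h c).
Proof.
move=> /inO_type ct hh; apply/inO_type; apply: same_type_trans ct _.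
by apply: same_type_over_aut hh _ => i; rewrite ffunE.
Qed.

Lemma inO_increasing c : inO c -> increasing c.
Proof.
by move=> /inO_type[_ _ co] i j /(proj2 ha); rewrite (co (inl i) (inl j)).
Qed.

Lemma inO_notin c i : inO c -> c i \notin S.
Proof.
move=> [h [hh ->]]; rewrite ffunE; apply/negP => hS.
have /(autS_injective hh) e := proj2 hh _ hS.
by have := proj1 ha i; rewrite -e hS.
Qed.

Definition pair_map c d (z : 'I_n + 'I_n) : A :=
  match z with inl i => c i | inr i => d i end.

(** The right-hand sides mention only [a]: every duo realises the blow-up of [a] in which each entry
    is doubled. *)
Lemma duo_pair_type c d : duo c d ->
  [/\ forall r z, urel (ored MA) r (pair_map c d z) =
                  urel (ored MA) r (a (blowup_base id z)),
      forall r z w, brel (ored MA) r (pair_map c d z) (pair_map c d w) =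
                  brel (ored MA) r (a (blowup_base id z)) (a (blowup_base id w))
    & forall z w, olt MA (pair_map c d z) (pair_map c d w) =
       (blowup_base id z < blowup_base id w)%N ||
       (blowup_base id z == blowup_base id w) && (~~ is_inr z && is_inr w)].
Proof.
move=> [cO [dO [cd [dc R]]]].
have [cu cb _] := (inO_type c).1 cO; have [du db _] := (inO_type d).1 dO.
have ci := inO_increasing cO; have di := inO_increasing dO.
split=> [r [i|i]|r [i|i] [j|j]|[i|i] [j|j]] /=.
- by rewrite (cu r (inl i)).
- by rewrite (du r (inl i)).
- by rewrite (cb r (inl i) (inl j)).
- by have [-> _] := R r i j; rewrite (cb r (inl i) (inl j)).
- by have [_ [_ <-]] := R r i j; rewrite (db r (inl i) (inl j)).
- by rewrite (db r (inl i) (inl j)).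
- by rewrite increasing_olt // andbF orbF.
- rewrite andbT; case: (ltngtP i j) => [ij|ji|/val_inj ->].
  + exact: olt_trans (cd i) (di _ _ ij).
  + by rewrite -val_eqE (gtn_eqF ji) (olt_asym (dc _ _ ji)).
  + by rewrite cd eqxx.
- rewrite andbF orbF; case: (ltngtP i j) => [/dc//|ji|/val_inj ->].
  + by apply: olt_asym; exact: olt_trans (cd _) (di _ _ ji).
  + exact: olt_asym.
- by rewrite increasing_olt // andbF orbF.
Qed.

(** Relations being binary, one with a point of [S] involves a single entry of the duo, and that
    entry belongs to a tuple of the orbit. *)
Lemma duo_pair_type_S c d (z : 'I_n + 'I_n) (s : seq_sub S) : duo c d ->
  [/\ forall r, brel (ored MA) r (pair_map c d z) (ssval s) =
                brel (ored MA) r (a (blowup_base id z)) (ssval s),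
      forall r, brel (ored MA) r (ssval s) (pair_map c d z) =
                brel (ored MA) r (ssval s) (a (blowup_base id z)),
      olt MA (pair_map c d z) (ssval s) = olt MA (a (blowup_base id z)) (ssval s)
    & olt MA (ssval s) (pair_map c d z) = olt MA (ssval s) (a (blowup_base id z))].
Proof.
move=> [/inO_type[cu cb co] [/inO_type[du db do_] _]].
case: z => i /=; split.
- by move=> r; rewrite (cb r (inl i) (inr s)).
- by move=> r; rewrite (cb r (inr s) (inl i)).
- by rewrite (co (inl i) (inr s)).
- by rewrite (co (inr s) (inl i)).
- by move=> r; rewrite (db r (inl i) (inr s)).
- by move=> r; rewrite (db r (inr s) (inl i)).
- by rewrite (do_ (inl i) (inr s)).
- by rewrite (do_ (inr s) (inl i)).
Qed.

Lemma duo_conjugate c d c' d' : duo c d -> duo c' d' ->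
  exists h, [/\ autS MA S h, tmap h c = c' & tmap h d = d'].
Proof.
move=> D D'.
have [u b o] := duo_pair_type D; have [u' b' o'] := duo_pair_type D'.
have [|h [hh he]] := @homogeneity_over _ (pair_map c d) (pair_map c' d').
  split=> [r [z|s]|r [z|s] [w|t]|[z|s] [w|t]] //=.
  - by rewrite u u'.
  - by rewrite b b'.
  - by have [-> _ _ _] := duo_pair_type_S z t D; have [-> _ _ _] := duo_pair_type_S z t D'.
  - by have [_ -> _ _] := duo_pair_type_S w s D; have [_ -> _ _] := duo_pair_type_S w s D'.
  - by rewrite o o'.
  - by have [_ _ -> _] := duo_pair_type_S z t D; have [_ _ -> _] := duo_pair_type_S z t D'.
  - by have [_ _ _ ->] := duo_pair_type_S w s D; have [_ _ _ ->] := duo_pair_type_S w s D'.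
exists h; split=> //; apply/ffunP => i; rewrite ffunE.
  exact: (he (inl i)).
exact: (he (inr i)).
Qed.

(** Choosing one entry from each pair is a section [sg] of [blowup_base id], and along a section the
    doubled structure restricts to that of [a]. *)
Lemma duo_cJ_inO c d J : duo c d -> inO (cJ c d J).
Proof.
move=> D; apply/inO_type.
pose sg i : 'I_n + 'I_n := if i \in J then inr i else inl i.
have cJE i : cJ c d J i = pair_map c d (sg i) by rewrite ffunE /sg; case: ifP.
have sgK i : blowup_base id (sg i) = i by rewrite /sg; case: ifP.
have [u b o] := duo_pair_type D.
split=> [r [i|s]|r [i|s] [j|t]|[i|s] [j|t]] //=; rewrite ?cJE.
- by rewrite u sgK.
- by rewrite b !sgK.
- by have [-> _ _ _] := duo_pair_type_S (sg i) t D; rewrite sgK.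
- by have [_ -> _ _] := duo_pair_type_S (sg j) s D; rewrite sgK.
(* Equal bases force [i = j], so the tie-breaking term of the order is false. *)
- rewrite o !sgK (increasing_olt _ _ (proj2 ha)).
  by case: (eqVneq i j) => [->|_]; rewrite ?andNb ?orbF //=.
- by have [_ _ -> _] := duo_pair_type_S (sg i) t D; rewrite sgK.
- by have [_ _ _ ->] := duo_pair_type_S (sg j) s D; rewrite sgK.
Qed.

Lemma exists_twin_duo (T : seq A) c :
  {subset S <= T} -> inO c -> (forall i, c i \in T) ->
  exists d, duo c d /\ forall J : {set 'I_n}, exists h,
    [/\ autS MA S h,
        forall t, t \in T -> (forall i, i \in J -> t != c i) -> h t = t
      & forall i, i \in J -> h (c i) = d i].
Proof.
move=> ST cO cT; have cI := increasing_inj (inO_increasing cO).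
pose c' i : seq_sub T := SeqSub (cT i).
have c'I : injective c' by move=> i j /(congr1 val) /cI.
have [e [eT [[_ [eu eb]] eo]]] := twins c'I.
pose d : tup A n := [ffun i => e (inr i)].
have hJ (J : {set 'I_n}) : exists h,
    [/\ autS MA S h,
        forall t, t \in T -> (forall i, i \in J -> t != c i) -> h t = t
      & forall i, i \in J -> h (c i) = d i].
  (* Again a section of the base map, hence type-preserving: [c i] goes to its twin for [i] in [J],
     any other point to itself. *)
  pose sg (t : seq_sub T) : seq_sub T + 'I_n :=
    if [pick i in J | t == c' i] is Some i then inr i else inl t.
  have sgK t : blowup_base c' (sg t) = t.
    by rewrite /sg; case: pickP => // i /andP[_ /eqP ->].
  have sg_id t : (forall i, i \in J -> ssval t != c i) -> sg t = inl t.
    move=> tc; rewrite /sg; case: pickP => // i /andP[/tc iJ /eqP ti].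
    by rewrite ti eqxx in iJ.
  have [|h [hh he]] := @homogeneity (seq_sub T) (@ssval _ T) (fun t => e (sg t)).
    split=> [r x|r x y|x y].
    - by rewrite eu /= sgK.
    - by rewrite eb /= !sgK.
    - rewrite eo /= !sgK.
      by case: (eqVneq x y) => [->|_]; rewrite ?andNb ?orbF.
  have hT t : t \in T -> (forall i, i \in J -> t != c i) -> h t = t.
    by move=> tT tc; rewrite (he (SeqSub tT)) sg_id // eT.
  exists h; split=> //.
    (* No [c i] lies in [S], so [h] fixes [S] pointwise. *)
    split=> // s sS; apply: hT (ST _ sS) _ => i _.
    by apply: contraTneq sS => ->; exact: inO_notin.
  move=> i iJ; rewrite (he (c' i)) ffunE /sg.
  case: pickP => [k /andP[_ /eqP/c'I ->] //|/(_ i)].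
  by rewrite iJ eqxx.
exists d; split=> //; have ci := inO_increasing cO.
split=> //; split.
  (* For the full index set, [h] carries all of [c] to [d]. *)
  have [h [hh _ hc]] := hJ setT.
  suff -> : d = tmap h c by exact: inO_tmap.
  by apply/ffunP => i; rewrite [RHS]ffunE hc ?inE.
have cE i : c i = e (inl (c' i)) by rewrite eT.
split; first by move=> i; rewrite cE ffunE eo /= eqxx orbT.
split; first by move=> i j /ci ij; rewrite cE ffunE eo /= ij.
by move=> r i j /=; rewrite !cE !ffunE !eb.
Qed.

(** * Cogs and alternating sums *)

Variable F : fieldType.
Implicit Types v w : vec A n F.

Lemma cog_tmap c d h e : injective h ->
  cog F (tmap h c) (tmap h d) (tmap h e) = cog F c d e.
Proof.
move=> hI; apply: eq_bigr => J _; congr (_ * _%:R).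
rewrite -[in RHS](inj_eq (tmap_injective hI)); congr (nat_of_bool (_ == _)).
by apply/ffunP => i; rewrite !ffunE; case: ifP.
Qed.

(** Only the empty [J] contributes, since [d i] differs from [c i]. In particular cogs are
    nonzero. *)
Lemma cog_diag c d : duo c d -> cog F c d c = 1.
Proof.
move=> [_ [_ [cd _]]]; rewrite /cog (bigD1 set0) //= big1 => [|J /set0Pn[i iJ]].
  rewrite cards0 mul1r addr0 (_ : cJ c d set0 = c) ?eqxx //.
  by apply/ffunP => i; rewrite ffunE inE.
rewrite (_ : (c == _) = false) ?mulr0 //; apply/negP => /eqP/ffunP/(_ i).
by rewrite ffunE iJ => e; have := cd i; rewrite -e olt_irr.
Qed.

Lemma inCog_cog c d : duo c d -> inCog MA S a (cog F c d).
Proof.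
move=> D; exists 1%N, (fun=> 1), (fun=> c), (fun=> d); split=> // e.
by rewrite big_ord1 mul1r.
Qed.

Lemma inCog_inLin v : inCog MA S a v -> inLin MA S a v.
Proof.
move=> [m [r [c [d [D vE]]]]].
have supp x : v x != 0 -> exists k, exists J, x = cJ (c k) (d k) J.
  move=> vx; apply: NNPP => nx; move/eqP: vx; case.
  rewrite vE big1 // => k _; rewrite /cog big1 ?mulr0 // => J _.
  case: eqP => [xE|]; last by rewrite mulr0.
  by case: nx; exists k, J.
split=> [|x /supp[k [J ->]]]; last exact: duo_cJ_inO.
exists [seq cJ (c k) (d k) J | k <- enum 'I_m, J <- enum {set 'I_n}].
move=> x /supp[k [J ->]]; apply/allpairsP; exists (k, J).
by rewrite /= !mem_enum.
Qed.

(** Each [J] without [i] pairs off with [i |: J], whose term has the opposite sign. *)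
Lemma alternating_sum_eq0 (i : 'I_n) (f : {set 'I_n} -> F) :
  (forall J, f (i |: J) = f J) -> \sum_(J : {set 'I_n}) (-1) ^+ #|J| * f J = 0.
Proof.
move=> fi; rewrite (bigID (fun J : {set 'I_n} => i \in J)) /=.
rewrite (reindex_onto (fun J => i |: J) (fun J => J :\ i)) /=; last first.
  by move=> J iJ; rewrite setD1K.
rewrite [X in X + _](eq_bigl (fun J : {set 'I_n} => i \notin J)) => [|J]; last first.
  rewrite setU11 /=; apply/eqP/idP => [<-|iJ]; first by rewrite !inE eqxx.
  by rewrite setU1K.
rewrite -big_split big1 //= => J iJ.
by rewrite cardsU1 iJ fi exprS mulN1r mulNr addNr.
Qed.

(** * Invariant subspaces contain all cogs *)

Section InvariantSubspace.
Variable V : vec A n F -> Prop.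
Hypotheses (subV : subspace V) (invV : aut_invariant MA S V).

(** A predicate on coefficient functions need not respect pointwise equality; invariance under the
    identity supplies this, because [aut_invariant] admits any [w] with the prescribed values. *)
Lemma subspace_ext v w : V v -> (forall e, w e = v e) -> V w.
Proof.
move=> Vv e; apply: (invV autS_id Vv) => c.
by rewrite -e; congr w; apply/ffunP => i; rewrite ffunE.
Qed.

Lemma subspace_sum (I : Type) (s : seq I) (r : I -> F) (f : I -> vec A n F) :
  (forall i, V (f i)) -> V (fun e => \sum_(i <- s) r i * f i e).
Proof.
move=> Vf; have [V0 [VD VZ]] := subV.
elim: s => [|i s IH]; first by apply: (subspace_ext V0) => e; rewrite big_nil.
by apply: (subspace_ext (VD _ _ (VZ (r i) _ (Vf i)) IH)) => e; rewrite big_cons.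
Qed.

Lemma subspace_contains_cog v c : V v -> inLin MA S a v -> v c != 0 ->
  exists d, duo c d /\ V (cog F c d).
Proof.
move=> Vv [[s vs] vO] vc; have cO := vO _ vc.
pose T := S ++ flatten [seq codom (x : tup A n) | x : tup A n <- s].
have ST : {subset S <= T} by move=> x; rewrite mem_cat => ->.
have sT x i : x \in s -> x i \in T.
  move=> xs; rewrite mem_cat; apply/orP; right.
  by apply/flattenP; exists (codom x); rewrite ?codom_f //; apply/mapP; exists x.
have [d [D hJ]] := exists_twin_duo ST cO (fun i => sT _ i (vs _ vc)).
exists d; split=> //.
have /fin_all_exists[h {}hJ] := hJ.
have /fin_all_exists[g gK] : forall J, exists g, cancel (h J) g /\ cancel g (h J).
  by move=> J; have [[[[g g1 g2] _] _] _ _] := hJ J; exists g.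
(* The coefficient function of [h J] applied to [v] is [v] composed with the inverse [g J]. *)
have VJ J : V (fun e => v (tmap (g J) e)).
  have [hS _ _] := hJ J; apply: (invV hS Vv) => e; congr v.
  by apply/ffunP => i; rewrite !ffunE (proj1 (gK J)).
(* The alternating sum will be [v c] times the cog, hence the factor [(v c)^-1]. *)
have := proj2 (proj2 subV) (v c)^-1 _
  (subspace_sum (index_enum {set 'I_n}) (fun J => (-1) ^+ #|J|) VJ).
move=> /subspace_ext; apply=> e.
(* Expansion of [v] in basis vectors; [undup] makes each tuple count once. *)
have vE y : v y = \sum_(x <- undup s) v x * (y == x)%:R.
  case: (eqVneq (v y) 0) => [vy|vy].
    rewrite vy big1 // => x _; case: eqP => [<-|]; last by rewrite mulr0.
    by rewrite vy mul0r.
  rewrite (bigD1_seq y) ?undup_uniq ?mem_undup ?vs //= eqxx mulr1.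
  by rewrite big1 ?addr0 // => x; rewrite eq_sym => /negbTE ->; rewrite mulr0.
have gE J x : (tmap (g J) e == x) = (e == tmap (h J) x).
  have [k1 k2] := gK J; apply/eqP/eqP => [<-|->];
  by apply/ffunP => i; rewrite !ffunE ?k1 ?k2.
have -> : \sum_(J : {set 'I_n}) (-1) ^+ #|J| * v (tmap (g J) e) =
    \sum_(x <- undup s) v x *
      \sum_(J : {set 'I_n}) (-1) ^+ #|J| * (e == tmap (h J) x)%:R.
  under eq_bigr => J _ do rewrite vE mulr_sumr.
  rewrite exchange_big /=; apply: eq_bigr => x _.
  by rewrite mulr_sumr; apply: eq_bigr => J _; rewrite gE mulrCA.
(* The term of [c] is the cog, as [h J] carries [c] to [cJ c d J]; all other terms must vanish. *)
rewrite (bigD1_seq c) ?undup_uniq ?mem_undup ?vs //= [X in _ + X]big1_seq ?addr0.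
  rewrite mulKf //; apply: eq_bigr => J _; congr (_ * (_ == _)%:R).
  have [_ h1 h2] := hJ J; apply/ffunP => i; rewrite !ffunE.
  case: ifP => [/h2 //|iJ]; rewrite h1 ?sT ?vs // => k kJ.
  apply: contraFneq iJ => /(increasing_inj (inO_increasing cO)) -> //.
move=> x /andP[xc]; rewrite mem_undup => xs.
(* The list [s] may contain tuples outside the support, whose coefficient is zero. *)
case: (eqVneq (v x) 0) => [->|/vO xO]; first by rewrite mul0r.
have [i ix] : exists i, c i \notin codom x.
  apply/existsP; rewrite -negb_forall; apply: contraNN xc => /forallP cx.
  by rewrite (increasing_codom_eq (inO_increasing cO) (inO_increasing xO) cx).
rewrite (alternating_sum_eq0 (i := i)) ?mulr0 // => J; congr (_ == _)%:R.
apply/ffunP => j; rewrite !ffunE.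
have [_ h1 h2] := hJ J; have [_ h1' h2'] := hJ (i |: J).
have xji : x j != c i by apply: contraNneq ix => <-; rewrite codom_f.
(* Either [x j] is some [c k] with [k] in [J], which both maps send to [d k], or both maps fix
   it. *)
case: (pickP (fun k => (k \in J) && (x j == c k))) => [k /andP[kJ /eqP ->]|nk].
  by rewrite h2 ?h2' // !inE kJ orbT.
have xJ k : k \in J -> x j != c k by move=> kJ; have := nk k; rewrite kJ => /negbT.
rewrite h1 ?h1' ?sT // => k; rewrite !inE => /orP[/eqP -> //|]; exact: xJ.
Qed.

(** One cog in [V] is enough, since all duos are conjugate and [V] is invariant. *)
Lemma subspace_contains_inCog v c w :
  V v -> inLin MA S a v -> v c != 0 -> inCog MA S a w -> V w.
Proof.
move=> Vv vL vc [m [r [p [q [D wE]]]]].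
have [d [cd Vcd]] := subspace_contains_cog Vv vL vc.
apply: (subspace_ext _ wE); apply: subspace_sum => k.
have [h [hS <- <-]] := duo_conjugate cd (D k).
by apply: (invV hS Vcd) => e; rewrite cog_tmap //; exact: autS_injective hS.
Qed.

End InvariantSubspace.

Lemma exists_nonzero_inCog : exists v c, inCog MA S a v /\ v c != 0.
Proof.
have [||i|d [D _]] := @exists_twin_duo (S ++ codom a) a.
- by move=> x; rewrite mem_cat => ->.
- exact: inO_refl.
- by rewrite mem_cat codom_f orbT.
exists (cog F a d), a; split; first exact: inCog_cog.
by rewrite cog_diag ?oner_neq0.
Qed.

End Fraisse.

Theorem mainTheorem13
  (nu nb : nat) (Jf : Type) (Fdom : Jf -> finType)
  (Fstr : forall j, sig0str nu nb (Fdom j))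
  (hF : forb_family_ok Fstr)
  (A : countType) (MA : ostr nu nb A) (hA : fraisse_limit Fstr MA)
  (F : fieldType) (S : seq A) (n : nat) (a : tup A n)
  (ha : S_ordered MA S a) :
  (forall V : vec A n F -> Prop,
      subspace V -> aut_invariant MA S V ->
      (forall v, V v -> inLin MA S a v) ->
      (exists v c, V v /\ v c != 0) ->
      forall v, inCog MA S a v -> V v)
  /\ (exists (v : vec A n F) c, inCog MA S a v /\ v c != 0)
  /\ (forall W : vec A n F -> Prop,
      subspace W -> aut_invariant MA S W ->
      (forall v, W v -> inCog MA S a v) ->
      (forall v, W v -> forall c, v c = 0) \/ (forall v, inCog MA S a v -> W v)).
Proof.
have contains (V : vec A n F -> Prop) : subspace V -> aut_invariant MA S V ->
    (forall v, V v -> inLin MA S a v) -> (exists v c, V v /\ v c != 0) ->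
    forall v, inCog MA S a v -> V v.
  move=> subV invV VL [v [c [Vv vc]]] w.
  exact: (subspace_contains_inCog hF hA ha subV invV Vv (VL v Vv) vc).
split=> //; split; first exact: (exists_nonzero_inCog hF hA ha).
move=> W subW invW WC.
(* A nonzero [W] falls under the first claim, since combinations of cogs lie in the linear span of
   the orbit. *)
case: (classic (exists v c, W v /\ v c != 0)) => [nz|z]; [right|left].
  by apply: contains => // v /WC; exact: (inCog_inLin hA ha).
move=> v Wv c; apply/eqP; apply: contra_notT z => vc.
by exists v, c.
Qed.
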